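(* (1) A twin-free, connected hypergraph has, up to reversal, at most one tight interval ordering. (2) A twin-free, strictly connected hypergraph has, up to reversal, at most one tight arc ordering.
   Context: A hypergraph $\mathcal{H}$ consists of a finite vertex set $V$ and a family of subsets of $V$ (hyperedges). An interval ordering is a linear ordering of $V$ in which every hyperedge is an interval of consecutive vertices; it is tight if for any hyperedges $A,B$ with $\emptyset\neq A\subseteq B$ the intervals corresponding to $A$ and $B$ share an endpoint. A circular ordering of $V$ is given by a circular successor relation; an arc is a set of consecutive vertices in it, written $[a,b]$ with endpoints $a,b$ when it is neither empty nor all of $V$ (the complete arc $V$ and the empty arc have no endpoints). An arc ordering is a circular ordering of $V$ in which every hyperedge is an arc; it is tight if for any hyperedges $A,B$ with $\emptyset\neq A\subseteq B\neq V$ the arcs $A$ and $B$ share an endpoint. Up to reversal means up to reversing the (linear or circular) order. Two distinct vertices are twins if every hyperedge contains both or neither. $\mathcal{H}$ is connected if every vertex lies in a hyperedge and the graph on the hyperedges, with adjacency meaning nonempty intersection, is connected. For nonempty $A,B\subseteq V$: they strictly overlap if $A\cap B\ne\emptyset$, neither contains the other, and $A\cup B\neq V$; they strictly intersect if they strictly overlap or $A\subseteq B$ or $B\subseteq A$. $\mathcal{H}$ is strictly connected if every vertex lies in a hyperedge and the graph on the hyperedges with adjacency meaning strict intersection is connected.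
   Formalization: Part (2) adds: if V is itself a hyperedge, the strict-intersection graph on the other hyperedges must be connected. Without this it is false: for |V|=4 with all singletons and V as hyperedges, every circular ordering is a tight arc ordering. *)

(* Defs.v *)
From mathcomp Require Import all_boot all_fingroup.
Set Implicit Arguments.
Unset Strict Implicit.
Unset Printing Implicit Defensive.

(* A hypergraph is a finite type V of vertices with its set E : {set {set V}}
   of hyperedges; the empty set and [set: V] are allowed as hyperedges. *)

Section Hypergraph.
Variable V : finType.
Implicit Types (E : {set {set V}}) (A B : {set V}).

Definition twins E (x y : V) : Prop :=
  x <> y /\ forall A, A \in E -> (x \in A) = (y \in A).

Definition twin_free E : Prop := forall x y, ~ twins E x y.

Definition covers E : Prop := forall x : V, exists2 A, A \in E & x \in A.

(* The graph with vertex set E and adjacency adj is connected. *)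
Definition graph_connected E (adj : rel {set V}) : Prop :=
  forall A B, A \in E -> B \in E ->
    connect [rel C D | [&& C \in E, D \in E & adj C D]] A B.

Definition intersects : rel {set V} := [rel A B | A :&: B != set0].

Definition connected E : Prop := covers E /\ graph_connected E intersects.

Definition strictly_overlap : rel {set V} :=
  [rel A B | [&& A :&: B != set0, ~~ (A \subset B), ~~ (B \subset A)
                & A :|: B != [set: V]]].

Definition strictly_intersect : rel {set V} :=
  [rel A B | [&& A != set0, B != set0 &
     [|| strictly_overlap A B, A \subset B | B \subset A]]].

Definition strictly_connected E : Prop :=
  covers E /\ graph_connected E strictly_intersect.

Definition linear_ordering (le : rel V) : Prop :=
  [/\ reflexive le, antisymmetric le, transitive le & total le].

Definition segment (le : rel V) (a b : V) : {set V} :=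
  [set x | le a x && le x b].

Definition is_interval (le : rel V) A : Prop :=
  A = set0 \/ exists a b, A = segment le a b.

Definition interval_endpoint (le : rel V) A (x : V) : Prop :=
  A != set0 /\ exists y, A = segment le x y \/ A = segment le y x.

Definition interval_ordering E (le : rel V) : Prop :=
  linear_ordering le /\ forall A, A \in E -> is_interval le A.

Definition tight_interval_ordering E (le : rel V) : Prop :=
  interval_ordering E le /\
  forall A B, A \in E -> B \in E -> A != set0 -> A \subset B ->
    exists x, interval_endpoint le A x /\ interval_endpoint le B x.

(* A circular ordering is represented by its successor map s, a permutation
   of V with a single cycle; the reversed ordering is s^-1. *)
Definition circular_ordering (s : {perm V}) : Prop :=
  forall x y, fconnect s x y.

(* findex s a x is the number of successor steps from a to x, so this is
   [a, b] = {a, s a, s (s a), ..., b}. *)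
Definition carc (s : {perm V}) (a b : V) : {set V} :=
  [set x | findex s a x <= findex s a b].

Definition is_arc (s : {perm V}) A : Prop :=
  [\/ A = set0, A = [set: V] | exists a b, A = carc s a b].

Definition arc_endpoint (s : {perm V}) A (x : V) : Prop :=
  [/\ A != set0, A != [set: V] &
      exists y, A = carc s x y \/ A = carc s y x].

Definition arc_ordering E (s : {perm V}) : Prop :=
  circular_ordering s /\ forall A, A \in E -> is_arc s A.

Definition tight_arc_ordering E (s : {perm V}) : Prop :=
  arc_ordering E s /\
  forall A B, A \in E -> B \in E ->
    A != set0 -> A \subset B -> B != [set: V] ->
    exists x, arc_endpoint s A x /\ arc_endpoint s B x.

End Hypergraph.

(* Main.v *)
Require Import Defs.
From mathcomp Require Import all_boot all_fingroup.
From mathcomp Require Import zify.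

Set Implicit Arguments.
Unset Strict Implicit.
Unset Printing Implicit Defensive.

(* Adding a point at infinity turns an interval ordering into an arc ordering
   in which intersecting hyperedges strictly intersect, so only the circular
   statement matters. A circular ordering is recorded by its ternary relation
   [cyc]; a set is convex when moving one vertex of a triple inside it, the other
   two being outside, does not change the orientation. If A and B strictly
   intersect, all cells of the Venn diagram of A and B are convex: this follows
   from nonemptiness of all four cells when A and B strictly overlap, and is
   exactly tightness when one contains the other.

   Compare two tight orderings through the sign of a triple, which tells whether
   they orient it in the same way. The triples separated by a strictly
   intersecting pair A, B all have the same sign, and this sign is the same for
   the pairs A, B and B, C. An arbitrary triple x, y, z with x isolated by A and y
   isolated by B is handled by induction on a path from A to B: if the next
   hyperedge C does not separate the triple, x may be moved to the side of C not
   containing y and z without changing any orientation. Hence all signs agree. *)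

Ltac mem_cases :=
  rewrite ?inE;
  repeat match goal with
  | H : is_true ?b |- _ => match b with context [in_mem _ _] => revert H end
  | H : ?b = _ |- _ => match b with context [in_mem _ _] => revert H end
  end;
  repeat (case: (_ \in _) => //=).

(** * Cyclic orientation of triples, and convex sets *)

Section CyclicOrder.
Variables (W : finType) (p : W -> nat).
Hypothesis p_inj : injective p.
Implicit Types (A B S : {set W}) (x y z w : W).

Definition cyc x y z :=
  [|| p x < p y < p z, p y < p z < p x | p z < p x < p y].

Definition cvx S := forall x x' y z,
  x \in S -> x' \in S -> y \notin S -> z \notin S -> cyc x y z = cyc x' y z.

Lemma pos_neq x y : x != y -> p x <> p y.
Proof. by move/eqP=> xy /p_inj. Qed.

Lemma cyc_rot x y z : cyc x y z = cyc y z x.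
Proof. rewrite /cyc; lia. Qed.

Lemma cyc_swap x y z : x != y -> y != z -> x != z -> cyc x z y = ~~ cyc x y z.
Proof. move=> /pos_neq xy /pos_neq yz /pos_neq xz; rewrite /cyc; lia. Qed.

Lemma notin_neq (S : {set W}) x y : x \in S -> y \notin S -> x != y.
Proof. by move=> xS; apply: contraNneq => <-. Qed.

(** Convexity says that no pair inside [S] crosses a pair outside it, and crossing is a symmetric
    relation between pairs. *)
Lemma cvxC S : cvx S -> cvx (~: S).
Proof.
move=> cS x x' y z; rewrite !inE !negbK => xS x'S yS zS.
have := cS _ _ _ _ yS zS xS x'S.
have := pos_neq (notin_neq yS xS); have := pos_neq (notin_neq yS x'S).
have := pos_neq (notin_neq zS xS); have := pos_neq (notin_neq zS x'S).
have [->//|/pos_neq] := eqVneq x x'; have [->|/pos_neq] := eqVneq y z.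
  by rewrite /cyc; lia.
rewrite /cyc; lia.
Qed.

(** Cutting the circle at [e] turns [cyc x y e] into a linear order, in which a positive triple is
    one of three chains. *)
Lemma cyc_from e x y z : x != e -> y != e -> z != e ->
  cyc x y z = [|| cyc x y e && cyc y z e, cyc y z e && cyc z x e
                | cyc z x e && cyc x y e].
Proof. move=> /pos_neq xe /pos_neq ye /pos_neq ze; rewrite /cyc; lia. Qed.

Lemma cyc_swap12 x y z : x != y -> y != z -> x != z -> cyc y x z = ~~ cyc x y z.
Proof. by move=> xy yz xz; rewrite cyc_rot cyc_swap. Qed.

Lemma cvx0 : cvx set0.
Proof. by move=> x x' y z; rewrite inE. Qed.

(** A vertex [e] outside [A :|: B] serves as a cut. For [y] outside [A :&: B], the convexity of [A]
    or of [B] fixes [cyc x y e], and [cyc_from] recovers the whole triple. *)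
Lemma cvxI A B : cvx A -> cvx B -> A :|: B != setT -> cvx (A :&: B).
Proof.
move=> cA cB; rewrite -subTset => /subsetPn[e _]; rewrite inE => /norP[eA eB].
have aux x x' y : x \in A :&: B -> x' \in A :&: B -> y \notin A :&: B ->
    cyc x y e = cyc x' y e.
  case/setIP=> xA xB /setIP[x'A x'B]; rewrite inE negb_and => /orP[yA|yB].
    exact: cA.
  exact: cB.
move=> x x' y z xI x'I yI zI.
have := aux _ _ _ xI x'I yI; have := aux _ _ _ xI x'I zI.
have ne u v : u \in A :&: B -> v \notin A :&: B -> u != v by apply: notin_neq.
have eI : e \notin A :&: B by rewrite inE negb_and eA.
have [ze|ze] := eqVneq z e; first by rewrite ze.
have [->|ye] := eqVneq y e.
  by move=> xz _; rewrite !(@cyc_swap _ z e) ?(ne x) ?(ne x') // xz.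
rewrite (@cyc_from e x y z) 1?(@cyc_from e x' y z) ?(ne x) ?(ne x') //.
rewrite (@cyc_swap12 x z e) ?(@cyc_swap12 x' z e) ?(ne x) ?(ne x') //.
by move=> -> ->.
Qed.

Lemma cvx_move S x x' y z : cvx S -> (x \in S) = (x' \in S) ->
  (y \in S) != (x \in S) -> (z \in S) != (x \in S) -> cyc x y z = cyc x' y z.
Proof.
move=> cS xx'; case xS: (x \in S) => yS zS.
  by apply: cS; rewrite -?xx' ?xS; move: yS zS; do 2 case: (_ \in S).
by apply: (cvxC cS); rewrite inE -?xx' ?xS; move: yS zS; do 2 case: (_ \in S).
Qed.

Lemma mem_neq S x y : (x \in S) != (y \in S) -> x != y.
Proof. by apply: contraNneq => ->. Qed.

(* The hypotheses put z, x, w, y in cyclic order, up to reversal. *)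
Lemma cyc_four_points A B x y z w : cvx A -> cvx B ->
  (x \in A) != (z \in A) -> (x \in B) = (z \in B) ->
  (y \in A) = (z \in A) -> (y \in B) != (z \in B) ->
  (w \in A) != (z \in A) -> (w \in B) != (z \in B) ->
  [/\ cyc w x z = ~~ cyc x y z, cyc w y z = cyc x y z
    & cyc x y w = ~~ cyc x y z].
Proof.
move=> cA cB xA xB yA yB wA wB.
have xw : cyc x y z = cyc w y z by apply: (cvx_move cA); mem_cases.
have yw : cyc y x z = cyc w x z by apply: (cvx_move cB); mem_cases.
have nxz := mem_neq xA; have nyz := mem_neq yB; have nwz := mem_neq wA.
have nxy : x != y by apply: (@mem_neq B); rewrite xB eq_sym.
have nwy : w != y by apply: (@mem_neq A); rewrite yA.
have nwx : w != x by apply: (@mem_neq B); rewrite xB.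
have Lwx : cyc w x z = ~~ cyc x y z by rewrite -yw cyc_swap12.
by split; rewrite // (@cyc_from z x y w) // (@cyc_swap12 w y z) // Lwx -xw; case: cyc.
Qed.

Definition cell A B x :=
  [set y | ((y \in A) == (x \in A)) && ((y \in B) == (x \in B))].

Definition isolates A x y z := ((x \in A) != (y \in A)) && ((x \in A) != (z \in A)).

Section Cells.
Variables A B : {set W}.
Hypotheses (cA : cvx A) (cB : cvx B) (cAB : forall x, cvx (cell A B x)).

Lemma cyc_cell_move x x' y z : x' \in cell A B x ->
  y \notin cell A B x -> z \notin cell A B x -> cyc x y z = cyc x' y z.
Proof. by apply: cAB; rewrite inE !eqxx. Qed.

Lemma cyc_cells x x' y y' z z' :
  x' \in cell A B x -> y' \in cell A B y -> z' \in cell A B z ->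
  y \notin cell A B x -> z \notin cell A B x -> z \notin cell A B y ->
  cyc x y z = cyc x' y' z'.
Proof.
rewrite !inE => x'x y'y z'z yx zx zy.
rewrite (@cyc_cell_move x x') ?inE; try by mem_cases.
rewrite cyc_rot (@cyc_cell_move y y') ?inE; try by mem_cases.
rewrite cyc_rot (@cyc_cell_move z z') ?inE; try by mem_cases.
by rewrite cyc_rot.
Qed.

(** The vertices of such a triple lie in three different cells, all determined by the cell of [z].
    The correction terms depend on memberships only, so they cancel when two orderings are
    compared. *)
Lemma cyc_isolated x y z x' y' z' :
  isolates A x y z -> isolates B y x z ->
  isolates A x' y' z' -> isolates B y' x' z' ->
  cyc x' y' z' = cyc x y z (+) ((z \in A) != (z' \in A)) (+) ((z \in B) != (z' \in B)).
Proof.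
move=> /andP[xyA xzA] /andP[yxB yzB] /andP[xyA' xzA'] /andP[yxB' yzB'].
have nxy : x != y by apply: contraNneq xyA => ->.
have nxz : x != z by apply: contraNneq xzA => ->.
have nyz : y != z by apply: contraNneq yzB => ->.
have four w : (w \in A) != (z \in A) -> (w \in B) != (z \in B) ->
  [/\ cyc w x z = ~~ cyc x y z, cyc w y z = cyc x y z
    & cyc x y w = ~~ cyc x y z].
  by apply: cyc_four_points => //; mem_cases.
(* The cell of [z'] is that of [z], of [y], of [x], or the fourth one. In the last three cases the
   vertex in the fourth cell is [x'], [y'], [z'] respectively, and [four] is applied to it. *)
have [zA|zA] := eqVneq (z \in A) (z' \in A);
have [zB|zB] := eqVneq (z \in B) (z' \in B); rewrite ?addbT ?addbF ?negbK.
- by symmetry; apply: cyc_cells; rewrite !inE; mem_cases.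
- have [||_ <- _] := four x'; try by mem_cases.
  have -> : cyc x' y' z' = cyc x' z y.
    by symmetry; apply: cyc_cells; rewrite !inE; mem_cases.
  by apply: cyc_swap => //; apply/eqP=> e; move: xyA' xzA' yxB' yzB'; subst; mem_cases.
- have [||<- _ _] := four y'; try by mem_cases.
  by rewrite -(cyc_rot z); symmetry; apply: cyc_cells; rewrite !inE; mem_cases.
- have [||_ _ e] := four z'; try by mem_cases.
  have -> : cyc x' y' z' = cyc y x z'.
    by symmetry; apply: cyc_cells; rewrite !inE; mem_cases.
  rewrite -[RHS]negbK -e.
  by apply: cyc_swap12 => //; apply/eqP=> e'; move: xyA' xzA' yxB' yzB'; subst; mem_cases.
Qed.
End Cells.

Lemma cvx_interval S a b : (forall x, (x \in S) = (a <= p x <= b)) -> cvx S.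
Proof.
move=> hS x x' y z; rewrite !hS => *; rewrite /cyc; lia.
Qed.
End CyclicOrder.

(** * Comparison of two tight orderings, with positions [p true] and [p false] *)

Section Rigidity.
Variables (W : finType) (E : {set {set W}}) (p : bool -> W -> nat).
Hypothesis p_inj : forall i, injective (p i).
Hypothesis E_nT : [set: W] \notin E.
Hypothesis E_cvx : forall i A, A \in E -> cvx (p i) A.
Hypothesis E_tight : forall i A B, A \in E -> B \in E -> A != set0 ->
  A \subset B -> cvx (p i) (B :\: A).
Implicit Types (A B C S : {set W}) (x y z : W) (i t : bool).

Notation adj := (@strictly_intersect W).

Lemma adj_sym A B : adj A B = adj B A.
Proof.
rewrite /strictly_intersect /strictly_overlap /= (setIC B) (setUC B).
by do 2![case: (_ == set0)]; do 2![case: (_ \subset _)]; case: (_ == set0).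
Qed.

Lemma cell_cvx_sub i A B x : A \in E -> B \in E -> A != set0 -> A \subset B ->
  cvx (p i) (cell A B x).
Proof.
move=> AE BE A0 /subsetP sAB.
case xA: (x \in A).
  have -> : cell A B x = A.
    apply/setP=> y; rewrite inE xA (sAB _ xA) eqb_id.
    by case yA: (y \in A) => //=; rewrite sAB.
  exact: E_cvx.
case xB: (x \in B).
  have -> : cell A B x = B :\: A by apply/setP=> y; rewrite !inE xA xB; mem_cases.
  by apply: E_tight => //; apply/subsetP.
have -> : cell A B x = ~: B.
  apply/setP=> y; rewrite !inE xA xB.
  by case yA: (y \in A) => /=; [rewrite sAB|case: (_ \in _)].
exact/cvxC/E_cvx.
Qed.

Lemma cellC A B x : cell A B x = cell B A x.
Proof. by apply/setP=> y; rewrite !inE andbC. Qed.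

(** Under strict overlap a cell is the intersection of two convex sets, and a vertex of the opposite
    cell lies outside both, as [cvxI] requires. *)
Lemma cell_cvx i A B x : A \in E -> B \in E -> adj A B -> cvx (p i) (cell A B x).
Proof.
move=> AE BE /and3P[A0 B0 /or3P[]]; last 2 first.
- exact: cell_cvx_sub.
- by rewrite cellC; apply: cell_cvx_sub.
case/and4P=> /set0Pn[a /setIP[aA aB]] /subsetPn[b bA bB] /subsetPn[c cB cA].
rewrite -subTset => /subsetPn[d _]; rewrite inE => /norP[dA dB].
have -> : cell A B x = (if x \in A then A else ~: A) :&: (if x \in B then B else ~: B).
  by apply/setP=> y; rewrite !inE; case: (x \in A); case: (x \in B); mem_cases.
have nT S (T : {set W}) y : y \notin S -> y \notin T -> S :|: T != setT.
  by move=> yS yT; apply/eqP=> /setP/(_ y); rewrite !inE (negPf yS) (negPf yT).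
have [cA' cB'] := (E_cvx i AE, E_cvx i BE).
case: (x \in A); case: (x \in B); apply: cvxI => //; try exact: cvxC.
- exact: (nT _ _ d).
- by apply: (nT _ _ c) => //; rewrite inE cB.
- by apply: (nT _ _ b) => //; rewrite inE bA.
- by apply: (nT _ _ a) => //; rewrite inE ?aA ?aB.
Qed.

Definition sign x y z := cyc (p true) x y z == cyc (p false) x y z.

Lemma sign_rot x y z : sign x y z = sign y z x.
Proof. by rewrite /sign !(cyc_rot _ x). Qed.

Lemma sign_swap x y z : x != y -> y != z -> x != z -> sign x z y = sign x y z.
Proof. by move=> xy yz xz; rewrite /sign !(@cyc_swap _ _ _ x y z) // (inj_eq negb_inj). Qed.

(** For [A = B] no triple qualifies and both values of [t] fit, hence the conditions [A != B]
    below. *)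
Definition signed t A B :=
  forall x y z, isolates A x y z -> isolates B y x z -> sign x y z = t.

Lemma sign_isolated A B x y z x' y' z' : A \in E -> B \in E -> adj A B ->
  isolates A x y z -> isolates B y x z ->
  isolates A x' y' z' -> isolates B y' x' z' -> sign x y z = sign x' y' z'.
Proof.
move=> AE BE AB h1 h2 h3 h4.
have cyc_i i := cyc_isolated (@p_inj i) (E_cvx i AE) (E_cvx i BE)
  (fun u => @cell_cvx i A B u AE BE AB) h1 h2 h3 h4.
by rewrite /sign !cyc_i; do 2 case: cyc; case: (_ != _); case: (_ != _).
Qed.

Lemma signed_sym t A B : signed t A B -> signed t B A.
Proof.
move=> AB x y z Bx Ay; rewrite -(AB _ _ _ Ay Bx) sign_rot.
case/andP: Bx => /mem_neq xy /mem_neq xz; case/andP: Ay => _ /mem_neq yz.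
by rewrite sign_swap // eq_sym.
Qed.

Lemma signed_exists A B : A \in E -> B \in E -> adj A B -> exists t, signed t A B.
Proof.
move=> AE BE AB.
pose P (u : W * W * W) := isolates A u.1.1 u.1.2 u.2 && isolates B u.1.2 u.1.1 u.2.
case: (pickP P) => [[[x y] z] /andP[/= Ax By]|P0].
  by exists (sign x y z) => x' y' z' Ax' By'; apply: (@sign_isolated A B).
by exists true => x y z Ax By; move: (P0 (x, y, z)); rewrite /P /= Ax By.
Qed.

(** With respect to [A], the vertex [z] sides with [x] or with [y], so [A] isolates the other one,
    while [B] isolates [z]. *)
Lemma signed_elim t A B x y z : signed t A B ->
  (x \in B) = (y \in B) -> (z \in B) != (x \in B) -> (x \in A) != (y \in A) ->
  sign x y z = t.
Proof.
move=> AB xyB zxB xyA.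
have xy := mem_neq xyA; have zx := mem_neq zxB.
have zy : z != y by apply: (@mem_neq _ B); rewrite -xyB.
have Bz : isolates B z x y by rewrite /isolates -xyB zxB.
have Bz' : isolates B z y x by rewrite /isolates -xyB zxB.
have [xzA|xzA] := eqVneq (x \in A) (z \in A).
  have Ay : isolates A y z x by rewrite /isolates -xzA eq_sym xyA.
  by rewrite -(AB _ _ _ Ay Bz') sign_rot.
have Ax : isolates A x z y by rewrite /isolates xzA.
by rewrite -(AB _ _ _ Ax Bz) sign_swap // eq_sym.
Qed.

(** The pair has some sign by [signed_exists], so a single separated triple determines it. *)
Lemma signed_intro t B C x y z : B \in E -> C \in E -> adj B C ->
  (x \in B) = (y \in B) -> (z \in B) != (x \in B) -> (x \in C) != (y \in C) ->
  sign x y z = t -> signed t B C.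
Proof.
move=> BE CE BC xyB zxB xyC <-.
have [t' BC'] := signed_exists BE CE BC.
by rewrite (signed_elim (signed_sym BC') xyB zxB xyC).
Qed.

(** * Propagation of the sign from one adjacent pair to the next *)

Definition cuts A S := exists x y, [/\ x \in S, y \in S & (x \in A) != (y \in A)].

(** If [C] does not separate a pair [a], [a'] cut by [A], take [d] across [C] from both; [A]
    separates [d] from one of them. *)
Lemma cuts_common A C S : cuts A S -> cuts C S ->
  exists x y, [/\ x \in S, y \in S, (x \in A) != (y \in A) & (x \in C) != (y \in C)].
Proof.
move=> [a [a' [aS a'S aa']]] [c [c' [cS c'S cc']]].
have [Ca|Ca] := eqVneq (a \in C) (a' \in C); last by exists a, a'.
have [d dS Cd] : exists2 d, d \in S & (d \in C) != (a \in C).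
  have [e|e] := eqVneq (c \in C) (a \in C); last by exists c.
  by exists c' => //; rewrite -e eq_sym.
have [Ad|Ad] := eqVneq (d \in A) (a \in A); last by exists d, a.
by exists d, a'; split; rewrite // ?Ad // -Ca.
Qed.

Lemma cuts_sub A B : A != set0 -> A \subset B -> A != B -> cuts A B.
Proof.
move=> /set0Pn[a aA] sAB nAB; have /subsetPn[b bB bA] : ~~ (B \subset A).
  by apply: contraNN nAB => sBA; rewrite eqEsubset sAB.
by exists a, b; rewrite (subsetP sAB) // aA (negPf bA).
Qed.

Lemma cuts_sup A B : A != setT -> B \subset A -> A != B -> cuts A (~: B).
Proof.
move=> AT sBA nAB; have [|||x [y [xB yB xyA]]] := @cuts_sub (~: A) (~: B).
- by apply: contraNneq AT => /(congr1 (@setC W)); rewrite setCK setC0 => ->.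
- by rewrite setCS.
- by rewrite (inj_eq (@setC_inj W)).
by exists x, y; split=> //; move: xyA; rewrite !inE; do 2 case: (_ \in A).
Qed.

Lemma E_neqT A : A \in E -> A != setT.
Proof. by move=> AE; apply: contraNneq E_nT => <-. Qed.

Lemma adj_cuts A B : A \in E -> B \in E -> adj A B -> A != B ->
  [\/ cuts A B /\ cuts A (~: B), A \subset B /\ cuts A B
    | B \subset A /\ cuts A (~: B)].
Proof.
move=> AE BE /and3P[A0 B0 /or3P[]] AB nAB; last 2 first.
- by apply: Or32; split=> //; apply: cuts_sub.
- by apply: Or33; split=> //; apply: cuts_sup => //; apply: E_neqT.
case/and4P: AB => /set0Pn[a /setIP[aA aB]] /subsetPn[b bA bB] /subsetPn[c cB cA].
rewrite -subTset => /subsetPn[d _]; rewrite inE => /norP[dA dB].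
apply: Or31; split; first by exists a, c; rewrite aA (negPf cA).
by exists b, d; rewrite !inE bA (negPf dA).
Qed.

(** One vertex is taken in each of [A], [B :\: A], [C :\: B] and [~: C]. Tightness makes [C :\: A]
    convex, and [cyc_four_points] for [B] and [C :\: A] forces the cyclic order of the four up to
    reversal. *)
Lemma sign_chain A B C : A \in E -> B \in E -> C \in E -> A != set0 ->
  A \subset B -> B \subset C -> A != B -> B != C ->
  exists x y z w, [/\ x \in B, y \in B, (x \in A) != (y \in A) &
     [/\ z \notin B, w \notin B, (z \in C) != (w \in C) & sign x y z = sign z w y]].
Proof.
move=> AE BE CE A0 sAB sBC nAB nBC.
have [x xA] := set0Pn _ A0.
have /subsetPn[y yB yA] : ~~ (B \subset A).
  by apply: contraNN nAB => sBA; rewrite eqEsubset sAB.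
have /subsetPn[z zC zB] : ~~ (C \subset B).
  by apply: contraNN nBC => sCB; rewrite eqEsubset sBC.
have := E_neqT CE; rewrite -subTset => /subsetPn[w _ wC].
have xB := subsetP sAB _ xA; have yC := subsetP sBC _ yB; have xC := subsetP sBC _ xB.
have wB : w \notin B by apply: contraNN wC; apply: (subsetP sBC).
have zA : z \notin A by apply: contraNN zB; apply: (subsetP sAB).
have wA : w \notin A by apply: contraNN wB; apply: (subsetP sAB).
exists x, y, z, w; split; rewrite ?xA ?(negPf yA) //; split; rewrite ?zC ?(negPf wC) //.
have cCA i : cvx (p i) (C :\: A) by apply: E_tight => //; apply: subset_trans sBC.
have cyc_i i : cyc (p i) x z y = ~~ cyc (p i) y z w.
  have [||||||_ -> ->] := @cyc_four_points _ _ (@p_inj i) B (C :\: A) x z w y (E_cvx i BE) (cCA i);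
  by rewrite // ?inE ?xA ?xB ?xC ?(negPf yA) ?yB ?yC ?(negPf zA) ?(negPf zB) ?zC
     ?(negPf wA) ?(negPf wB) ?(negPf wC).
have xy : x != y by apply: (@mem_neq _ A); rewrite xA (negPf yA).
have yz : y != z by apply: (@mem_neq _ B); rewrite yB (negPf zB).
have xz : x != z by apply: (@mem_neq _ B); rewrite xB (negPf zB).
by rewrite -sign_swap // -(sign_rot y z w) /sign !cyc_i (inj_eq negb_inj).
Qed.

Lemma signed_step t A B C : A \in E -> B \in E -> C \in E ->
  adj A B -> adj B C -> A != B -> B != C -> signed t A B -> signed t B C.
Proof.
move=> AE BE CE AB BC nAB nBC sAB.
have [A0 B0 _] := and3P AB; have [_ C0 _] := and3P BC.
(* If [A] and [C] cut the same side of [B], a pair cut by both and a vertex of the other side form a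
   triple separated by [A], [B] and also by [B], [C]. *)
have common S : S = B \/ S = ~: B -> cuts A S -> cuts C S -> signed t B C.
  move=> SB cA cC; have [x [y [xS yS xyA xyC]]] := cuts_common cA cC.
  have [z zS] : exists z, z \notin S.
    case: SB => ->.
      by have := E_neqT BE; rewrite -subTset => /subsetPn[z _ zB]; exists z.
    by have [z zB] := set0Pn _ B0; exists z; rewrite inE negbK.
  have [xyB zxB] : (x \in B) = (y \in B) /\ (z \in B) != (x \in B).
    by move: xS yS zS; case: SB => ->; rewrite ?inE; do 3 case: (_ \in B).
  apply: (@signed_intro t B C x y z) => //.
  exact: (signed_elim sAB).
have CB : adj C B by rewrite adj_sym.
have nCB : C != B by rewrite eq_sym.
have [[c1 c2]|[s1 c1]|[s1 c1]] := adj_cuts AE BE AB nAB;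
have [[c3 c4]|[s3 c3]|[s3 c3]] := adj_cuts CE BE CB nCB;
  try by [apply: (common B); tauto | apply: (common (~: B)); tauto].
(* Only the chains [A], [B], [C] and [C], [B], [A] remain, where no common side is cut. *)
- have [x [y [z [w [xB yB xyA [zB wB zwC e]]]]]] := sign_chain AE BE CE A0 s1 s3 nAB nBC.
  apply: (@signed_intro t B C z w y); rewrite ?(negPf zB) ?(negPf wB) ?yB //.
  by rewrite -e; apply: (signed_elim sAB); rewrite ?xB ?yB ?(negPf zB).
- have nBA : B != A by rewrite eq_sym.
  have [x [y [z [w [xB yB xyC [zB wB zwA e]]]]]] := sign_chain CE BE AE C0 s3 s1 nCB nBA.
  apply: (@signed_intro t B C x y z); rewrite ?xB ?yB ?(negPf zB) //.
  by rewrite e; apply: (signed_elim sAB); rewrite ?yB ?(negPf wB) ?(negPf zB).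
Qed.

Notation R := [rel C D | [&& C \in E, D \in E & adj C D]].

Lemma signed_all : graph_connected E adj -> exists t, forall A B,
  A \in E -> B \in E -> adj A B -> A != B -> signed t A B.
Proof.
move=> Econ.
pose P (u : {set W} * {set W}) := R u.1 u.2 && (u.1 != u.2).
case: (pickP P) => [[A0 B0] /andP[/and3P[/= A0E B0E AB0] nAB0]|P0]; last first.
  exists true => A B AE BE AB nAB; move: (P0 (A, B)).
  by rewrite /P /= AE BE AB nAB.
have [t sAB0] := signed_exists A0E B0E AB0.
exists t => C D CE DE CD nCD.
have [q Rq Cq] := connectP (Econ _ _ B0E CE).
elim: q A0 B0 A0E B0E AB0 nAB0 sAB0 Rq Cq => [|B q IH] A0 B0 A0E B0E AB0 nAB0 sAB0 /=.
  by move=> _ CB; rewrite CB in CD nCD *; apply: (signed_step A0E B0E).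
case/andP=> /and3P[_ BE BB0] Rq Cq.
(* Adjacency is reflexive on nonempty hyperedges, so repetitions in the path are skipped. *)
have [eB|nB] := eqVneq B0 B; first by subst B; apply: (IH A0 B0).
by apply: (IH B0 B) => //; apply: (signed_step A0E B0E).
Qed.

Section Signed.
Variable t : bool.
Hypothesis all_signed : forall A B,
  A \in E -> B \in E -> adj A B -> A != B -> signed t A B.

Lemma sign_path q A x y z : path R A q -> isolates A x y z ->
  isolates (last A q) y x z -> sign x y z = t.
Proof.
elim: q A x y z => [|C q IH] A x y z /=.
  by move=> _; rewrite /isolates; do 3 case: (_ \in A).
case/andP=> /and3P[AE CE AC] Rq Ax Dy.
have [eAC|nAC] := eqVneq A C; first by apply: (IH C); rewrite -?eAC // eAC.
have [xy xz] : x != y /\ x != z by case/andP: Ax => /mem_neq ? /mem_neq ?.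
have yz : y != z by case/andP: Dy => _ /mem_neq.
have sAC := all_signed AE CE AC nAC.
case Cy: (isolates C y x z); first exact: sAC.
case Cz: (isolates C z x y); first by rewrite -sign_swap //; apply: sAC => //; rewrite /isolates andbC.
case Cx: (isolates C x y z); first exact: (IH C).
have [Cxy Cxz] : (x \in C) = (y \in C) /\ (x \in C) = (z \in C).
  by move: Cx Cy Cz; rewrite /isolates; do 3 case: (_ \in C).
have [x' x'C] : exists x', (x' \in C) != (y \in C).
  case yC: (y \in C).
    have := E_neqT CE; rewrite -subTset => /subsetPn[u _ uC].
    by exists u; rewrite (negPf uC).
  have /and3P[_ /set0Pn[u uC] _] := AC.
  by exists u; rewrite uC.
(* The cell of [y] for [A] and [C] contains [z] but neither [x] nor [x'], and its complement is
   convex. *)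
have -> : sign x y z = sign x' y z.
  have yz_cell : z \in cell A C y.
    by case/andP: Ax; rewrite inE -Cxy -Cxz eqxx andbT; do 3 case: (_ \in A).
  have x_cell : x \notin cell A C y by case/andP: Ax => h _; rewrite inE negb_and h.
  have x'_cell : x' \notin cell A C y by rewrite inE negb_and x'C orbT.
  have y_cell : y \in cell A C y by rewrite inE !eqxx.
  rewrite /sign; congr (_ == _);
    by apply: (cvxC (@p_inj _) (@cell_cvx _ A C y AE CE AC)); rewrite inE ?negbK.
have Cx' : isolates C x' y z by rewrite /isolates -Cxz Cxy x'C.
(* If the move changes the side with respect to the last hyperedge, that hyperedge isolates [z]
   instead of [y], and these two exchange roles. *)
have [xD|xD] := eqVneq (x' \in last C q) (x \in last C q).
  by apply: (IH C) => //; move: Dy; rewrite /isolates xD.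
have [x'y x'z] : x' != y /\ x' != z by case/andP: Cx' => /mem_neq ? /mem_neq ?.
rewrite -sign_swap //; apply: (IH C) => //.
  by rewrite /isolates andbC.
by move: Dy xD; rewrite /isolates; do 4 case: (_ \in last C q).
Qed.

End Signed.

(** A hyperedge separating two vertices of a triple isolates one of the three. Another one separates
    the remaining two, and [sign_path] applies to a path between these hyperedges. *)
Lemma sign_constant : graph_connected E adj -> twin_free E ->
  exists t, forall x y z, x != y -> y != z -> x != z -> sign x y z = t.
Proof.
move=> Econ Etf; have [t sE] := signed_all Econ; exists t.
have sep x y : x != y -> exists2 A, A \in E & (x \in A) != (y \in A).
  move=> xy; case: (pickP [pred A in E | (x \in A) != (y \in A)]) => [A /andP[]|P0].
    by exists A.
  case: (Etf x y); split=> [|A AE]; first exact/eqP.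
  by have := P0 A; rewrite /= AE => /negbFE/eqP.
have iso2 A B x y z : A \in E -> B \in E -> isolates A x y z -> isolates B y x z ->
    sign x y z = t.
  move=> AE BE Ax By; have [q Rq eB] := connectP (Econ _ _ AE BE).
  by apply: (sign_path sE Rq) => //; rewrite -eB.
have iso1 A x y z : A \in E -> isolates A x y z -> y != z -> sign x y z = t.
  move=> AE Ax yz; have [B BE yzB] := sep _ _ yz.
  have [xy xz] : x != y /\ x != z by case/andP: Ax => /mem_neq ? /mem_neq ?.
  have [xyB|xyB] := eqVneq (y \in B) (x \in B).
    rewrite -sign_swap //; apply: (iso2 A B) => //; first by rewrite /isolates andbC.
    by rewrite /isolates -xyB eq_sym yzB.
  by apply: (iso2 A B) => //; rewrite /isolates xyB.
move=> x y z xy yz xz; have [A AE xyA] := sep _ _ xy.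
have [xzA|xzA] := eqVneq (x \in A) (z \in A).
  rewrite sign_rot; apply: (iso1 A) => //; last by rewrite eq_sym.
  by rewrite /isolates -xzA eq_sym xyA.
by apply: (iso1 A) => //; rewrite /isolates xyA.
Qed.
End Rigidity.

(** * Positions on a circular ordering, counted from a base vertex *)

Section CircularPositions.
Variables (V : finType) (s : {perm V}).
Hypothesis s_circ : circular_ordering s.
Implicit Types (A B S : {set V}) (a b o x y z : V).

Lemma order_circ x : fingraph.order s x = #|V|.
Proof. by rewrite /fingraph.order; apply: eq_card => y; rewrite inE s_circ. Qed.

Lemma findex_circ_max x y : findex s x y < #|V|.
Proof. by rewrite -(order_circ x) findex_max. Qed.

Lemma findex_inj x : injective (findex s x).
Proof. by move=> y z e; rewrite -(iter_findex (s_circ x y)) e iter_findex. Qed.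

Lemma findex_shift o a x : findex s a x =
  if findex s o a <= findex s o x then findex s o x - findex s o a
  else #|V| + findex s o x - findex s o a.
Proof.
(* Changing the base vertex is a subtraction modulo [#|V|]. *)
set k := RHS.
have ltx := findex_circ_max o x; have lta := findex_circ_max o a.
have ltk : k < #|V| by rewrite /k; case: ifP; lia.
suff <- : iter k s a = x by rewrite findex_iter ?order_circ.
rewrite -{1}(iter_findex (s_circ o a)) -iterD /k; case: ifP => le_ax.
  by rewrite subnK // iter_findex.
rewrite subnK ?iterD ?iter_findex //; last by lia.
by rewrite -(order_circ x) fingraph.iter_order //; apply: perm_inj.
Qed.

Lemma cyc_shift a o x y z : cyc (findex s a) x y z = cyc (findex s o) x y z.
Proof.
have := findex_circ_max o a; have := findex_circ_max o x.
have := findex_circ_max o y; have := findex_circ_max o z.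
rewrite /cyc !(findex_shift o a); do 3![case: ifP => ?]; lia.
Qed.

Lemma cvx_shift a o S : cvx (findex s a) S -> cvx (findex s o) S.
Proof. by move=> cS x x' y z *; rewrite !(cyc_shift o a); apply: cS. Qed.

Lemma arc_cvx o A : is_arc s A -> cvx (findex s o) A.
Proof.
case=> [->|->|[a [b ->]]]; first exact: cvx0.
  by move=> x x' y z; rewrite !inE.
apply: (@cvx_shift a); apply: (@cvx_interval _ _ _ 0 (findex s a b)) => x.
by rewrite inE.
Qed.

Lemma findex_succ_last x : findex s (s x) x = #|V|.-1.
Proof.
have V0 : 0 < #|V| by apply/card_gt0P; exists x.
suff {2}<- : iter #|V|.-1 s (s x) = x by rewrite findex_iter // order_circ prednK.
by rewrite -iterSr prednK // -(order_circ x) fingraph.iter_order //; apply: perm_inj.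
Qed.

(** Seen from [s x], the vertex [x] comes last, so the arcs ending at [x] are final segments. *)
Lemma mem_carc_last x y z :
  (z \in carc s y x) = (findex s (s x) y <= findex s (s x) z).
Proof.
rewrite inE !(findex_shift (s x) y) findex_succ_last.
have := findex_circ_max (s x) y; have := findex_circ_max (s x) z.
by do 2![case: ifP => ?]; lia.
Qed.

Lemma findex0_eq x y : findex s x y = 0 -> y = x.
Proof. by move=> e; rewrite -(iter_findex (s_circ x y)) e. Qed.

Lemma succ_fixed x y : s x = x -> y = x.
Proof. by move=> sx; rewrite -(iter_findex (s_circ x y)); elim: findex => //= n ->. Qed.

Lemma findex_succ x : s x != x -> findex s x (s x) = 1.
Proof.
move=> sx; have lt1 : 1 < #|V|.
  by rewrite (cardD1 x) (cardD1 (s x)) !inE sx.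
by rewrite -[s x]/(iter 1 s x) findex_iter // order_circ.
Qed.

(** Otherwise the larger arc contains [s x], and an arc running from there to [x] is complete. The
    next lemma but one argues in the same way with the predecessor of [x]. *)
Lemma carc_forward_backward x y y' : carc s x y \subset carc s y' x ->
  carc s y' x != setT -> y = x.
Proof.
move=> /subsetP sAB nT; apply/eqP/negPn/negP=> yx; case/negP: nT.
have fy : 0 < findex s x y by rewrite lt0n; apply: contraNN yx => /eqP/findex0_eq->.
have : s x \in carc s y' x.
  apply: sAB; rewrite inE findex_succ //; apply: contraNneq yx => /(succ_fixed y) ->.
  by [].
rewrite mem_carc_last findex0 leqn0 => /eqP e.
by apply/eqP/setP=> z; rewrite mem_carc_last e inE.
Qed.

Lemma carc_backward_forward x y y' : carc s y x \subset carc s x y' ->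
  carc s x y' != setT -> y = x.
Proof.
move=> /subsetP sAB nT; apply/eqP/negPn/negP=> yx; case/negP: nT.
have V0 : 0 < #|V| by apply/card_gt0P; exists x.
pose w := (s^-1)%g x; have sw : s w = x by rewrite permKV.
have qw : findex s x w = #|V|.-1 by rewrite -{1}sw findex_succ_last.
have wB : w \in carc s x y'.
  apply: sAB; rewrite inE (findex_shift x y w) (findex_shift x y x) findex0 qw.
  have := findex_circ_max x y; have : findex s x y != 0.
    by apply: contraNN yx => /eqP/findex0_eq->.
  by do 2![case: ifP => ?]; lia.
apply/eqP/setP=> z; move: wB; rewrite !inE qw.
by have := findex_circ_max x z; lia.
Qed.

(** If [x] is the first vertex of both arcs, or the last of both, the difference is an interval of
    positions. If the roles differ, [A] is the single vertex [x], which can be read either way. *)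
Lemma tight_cvx o A B x : A \subset B ->
  arc_endpoint s A x -> arc_endpoint s B x -> cvx (findex s o) (B :\: A).
Proof.
move=> sAB [_ _ [y eA]] [_ nT [y' eB]].
have fwd z z' : cvx (findex s o) (carc s x z' :\: carc s x z).
  apply: (@cvx_shift x).
  apply: (@cvx_interval _ _ _ (findex s x z).+1 (findex s x z')) => u.
  by rewrite !inE -ltnNge.
have bwd z z' : cvx (findex s o) (carc s z' x :\: carc s z x).
  apply: (@cvx_shift (s x)) => u u' v w.
  rewrite !in_setD !mem_carc_last /cyc; lia.
case: eA eB sAB nT => -> [] -> sAB nT; try by [apply: fwd | apply: bwd].
  by rewrite (carc_forward_backward sAB nT).
by rewrite (carc_backward_forward sAB nT).
Qed.

Lemma cyc_succ o x z : s x != x -> z != x -> z != s x -> cyc (findex s o) x (s x) z.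
Proof.
move=> sx zx zsx; rewrite (cyc_shift o x) /cyc findex0 findex_succ //.
have : findex s x z <> 0 by move/findex0_eq/eqP; rewrite (negPf zx).
have : findex s x z <> 1.
  by rewrite -(findex_succ sx) => /findex_inj/eqP; rewrite (negPf zsx).
lia.
Qed.

Lemma succ_of_cyc o x y : x != y ->
  (forall z, z != x -> z != y -> cyc (findex s o) x y z) -> s x = y.
Proof.
move=> xy cxy; have sx : s x != x.
  by apply: contraNneq xy => /(succ_fixed y) ->.
apply/eqP/negPn/negP=> sxy; rewrite eq_sym in sxy.
have xs : x != s x by rewrite eq_sym.
have := cyc_swap (@findex_inj o) xy sxy xs.
by rewrite cxy // 1?cyc_succ // eq_sym.
Qed.

End CircularPositions.

(** * Uniqueness of tight arc orderings *)

Section CircularUniqueness.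
Variables (V : finType) (E : {set {set V}}).

(** The full set strictly intersects every nonempty hyperedge but separates no vertices, so
    connectivity is asked for without it. *)
Lemma tight_arc_ordering_unique (s1 s2 : {perm V}) : twin_free E ->
  graph_connected (E :\ [set: V]) (@strictly_intersect V) ->
  tight_arc_ordering E s1 -> tight_arc_ordering E s2 ->
  s1 = s2 \/ s1 = (s2^-1)%g.
Proof.
move=> Etf Econ T1 T2.
case: (pickP (@predT V)) => [o _|V0]; last first.
  by left; apply/permP=> x; have := V0 x.
pose s i := if i then s1 else s2.
have sT i : tight_arc_ordering E (s i) by case: i.
have sc i : circular_ordering (s i) by case: (sT i) => [[]].
have p_inj i : injective (findex (s i) o) by apply: findex_inj.
have nT : [set: V] \notin E :\ setT by rewrite !inE eqxx.
have Ecvx i A : A \in E :\ setT -> cvx (findex (s i) o) A.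
  by case/setD1P=> _ AE; apply: arc_cvx => //; apply: (sT i).1.2.
have Etight i A B : A \in E :\ setT -> B \in E :\ setT -> A != set0 ->
    A \subset B -> cvx (findex (s i) o) (B :\: A).
  case/setD1P=> _ AE /setD1P[BT BE] A0 sAB.
  have [x [xA xB]] := (sT i).2 A B AE BE A0 sAB BT.
  exact: (tight_cvx (sc i) o sAB xA xB).
have Etf' : twin_free (E :\ setT).
  move=> x y [xy h]; apply: (Etf x y); split=> // A AE.
  have [->|AT] := eqVneq A setT; first by rewrite !inE.
  by apply: h; rewrite !inE AT.
have [t st] := sign_constant p_inj nT Ecvx Etight Econ Etf'.
have eqs x y z : x != y -> y != z -> x != z ->
    cyc (findex s2 o) x y z = (t == cyc (findex s1 o) x y z).
  by move=> xy yz xz; rewrite -(st x y z) // /sign /=; do 2 case: cyc.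
case: t {st} eqs => eqs; [left|right]; apply/permP=> x.
  have [sx|sx] := eqVneq (s1 x) x; first by rewrite sx (succ_fixed (sc true) (s2 x) sx).
  symmetry; apply: (succ_of_cyc (sc false) (o := o)); first by rewrite eq_sym.
  by move=> z zx zs; rewrite eqs 1?eq_sym // (cyc_succ (sc true)).
(* With opposite orientations, it remains to see that [x] follows [s1 x] in [s2]. *)
apply: (@perm_inj _ s2); rewrite permKV.
have [sx|sx] := eqVneq (s1 x) x; first by rewrite sx (succ_fixed (sc true) (s2 x) sx).
apply: (succ_of_cyc (sc false) (o := o)) => // z zs zx.
rewrite (cyc_swap12 (@findex_inj _ s2 (sc false) o)) 1?(eq_sym x) 1?(eq_sym _ z) //.
by rewrite eqs 1?(eq_sym x) 1?(eq_sym _ z) // (cyc_succ (sc true)).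
Qed.
End CircularUniqueness.

(** * Linear orderings closed into circles *)

Section LinearPositions.
Variables (V : finType) (le : rel V).
Hypothesis le_lin : linear_ordering le.
Implicit Types (A B : {set V}) (x y z : V).

(** Counting [x] itself keeps ranks positive and leaves position 0 free for the added point. *)
Definition rank x := #|[set y | le y x]|.

Lemma leq_rank x y : (rank x <= rank y) = le x y.
Proof.
have [le_refl le_anti le_trans le_total] := le_lin.
have mono u v : le u v -> [set y | le y u] \subset [set y | le y v].
  by move=> uv; apply/subsetP=> w; rewrite !inE => /le_trans; apply.
apply/idP/idP=> [|xy]; last exact/subset_leq_card/mono.
apply: contraTT => nxy; have yx : le y x by have := le_total x y; rewrite (negPf nxy).
rewrite -ltnNge; apply/proper_card/properP; split; first exact: mono.
by exists x; rewrite inE ?le_refl.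
Qed.

Lemma rank_inj x y : rank x = rank y -> x = y.
Proof.
have [_ le_anti _ _] := le_lin.
by move=> e; apply: le_anti; rewrite -!leq_rank e leqnn.
Qed.

Lemma rank_gt0 x : 0 < rank x.
Proof.
have [le_refl _ _ _] := le_lin.
by apply/card_gt0P; exists x; rewrite inE.
Qed.

(* The added point None plays the role of infinity: it closes the line into a circle. *)
Definition orank (o : option V) := if o is Some x then rank x else 0.

Lemma orank_inj : injective orank.
Proof.
move=> [x|] [y|] //= => [/rank_inj->//|e|e]; first by have := rank_gt0 x; rewrite e.
by have := rank_gt0 y; rewrite -e.
Qed.

Lemma cyc_orank x y : x != y -> cyc orank None (Some x) (Some y) = le x y.
Proof.
move=> /eqP xy; rewrite /cyc /= !ltn0 !andbF !orbF rank_gt0 -leq_rank ltn_neqAle.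
by case: eqP => // /rank_inj.
Qed.

Lemma mem_None A : (None \in Some @: A) = false.
Proof. by apply/negP=> /imsetP[]. Qed.

Lemma mem_Some A x : (Some x \in Some @: A) = (x \in A).
Proof. by rewrite mem_imset // => ? ? []. Qed.

Lemma mem_segment a b x : (x \in segment le a b) = (rank a <= rank x <= rank b).
Proof. by rewrite inE -!leq_rank. Qed.

Lemma interval_cvx A : is_interval le A -> cvx orank (Some @: A).
Proof.
case=> [->|[a [b ->]]]; first by rewrite imset0; apply: cvx0.
apply: (@cvx_interval _ _ _ (rank a) (rank b)) => -[x|].
  by rewrite mem_Some mem_segment.
by rewrite mem_None /=; have := rank_gt0 a; lia.
Qed.

Lemma interval_tight_cvx A B x : A \subset B ->
  interval_endpoint le A x -> interval_endpoint le B x ->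
  cvx orank (Some @: B :\: Some @: A).
Proof.
move=> sAB [A0 [y eA]] [_ [y' eB]].
have fwd z z' : cvx orank (Some @: segment le x z' :\: Some @: segment le x z).
  (* The maximum covers the case where [z] precedes [x] and the inner segment is empty. *)
  apply: (@cvx_interval _ _ _ (maxn (rank x) (rank z).+1) (rank z')) => -[u|];
    rewrite in_setD ?mem_None ?mem_Some ?mem_segment /=; first by lia.
  by have := rank_gt0 x; lia.
have bwd z z' : cvx orank (Some @: segment le z' x :\: Some @: segment le z x).
  apply: (@cvx_interval _ _ _ (rank z') (minn (rank x) (rank z).-1)) => -[u|];
    rewrite in_setD ?mem_None ?mem_Some ?mem_segment /=.
    by have := rank_gt0 z; lia.
  by have := rank_gt0 z'; lia.
have [a aA] := set0Pn _ A0.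
case: eA eB => eA [] eB; rewrite eA eB; try by [apply: fwd | apply: bwd].
  have -> : y = x; last exact: bwd.
  have : y \in B by apply: (subsetP sAB); move: aA; rewrite eA !mem_segment; lia.
  by move: aA; rewrite eA eB !mem_segment => *; apply: rank_inj; lia.
have -> : y = x; last exact: fwd.
have : y \in B by apply: (subsetP sAB); move: aA; rewrite eA !mem_segment; lia.
by move: aA; rewrite eA eB !mem_segment => *; apply: rank_inj; lia.
Qed.
End LinearPositions.

(** * Uniqueness of tight interval orderings *)

Section LinearUniqueness.
Variables (V : finType) (E : {set {set V}}).

(** The added point lies outside both images, so their union is never the full set. *)
Lemma strictly_intersect_Some (A B : {set V}) : intersects A B ->
  strictly_intersect (Some @: A) (Some @: B).
Proof.
case/set0Pn=> x /setIP[xA xB].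
have xA' : Some x \in Some @: A by rewrite mem_Some.
have xB' : Some x \in Some @: B by rewrite mem_Some.
apply/and3P; split; [by apply/set0Pn; exists (Some x)..|].
case: (boolP (_ \subset _)) => sAB; rewrite ?orbT //=.
case: (boolP (_ \subset _)) => sBA; rewrite ?orbT //= orbF.
apply/and4P; split=> //; first by apply/set0Pn; exists (Some x); rewrite inE xA'.
by apply/eqP=> /setP/(_ None); rewrite !inE !mem_None.
Qed.

Lemma tight_interval_ordering_unique (le1 le2 : rel V) :
  twin_free E -> connected E ->
  tight_interval_ordering E le1 -> tight_interval_ordering E le2 ->
  le1 =2 le2 \/ le1 =2 (fun x y => le2 y x).
Proof.
move=> Etf [Ecov Econ] T1 T2.
pose le i := if i then le1 else le2.
have leT i : tight_interval_ordering E (le i) by case: i.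
have lin i : linear_ordering (le i) by case: (leT i) => [[]].
pose E' := [set Some @: A | A : {set V} in E].
have p_inj i : injective (orank (le i)) by apply: orank_inj.
have nT : [set: option V] \notin E'.
  by apply/imsetP=> -[A _ /setP/(_ None)]; rewrite mem_None inE.
have Ecvx i A : A \in E' -> cvx (orank (le i)) A.
  by case/imsetP=> B BE ->; apply: interval_cvx => //; apply: (leT i).1.2.
have Etight i A B : A \in E' -> B \in E' -> A != set0 -> A \subset B ->
    cvx (orank (le i)) (B :\: A).
  case/imsetP=> A1 AE -> /imsetP[B1 BE ->] A0 sAB.
  have sAB1 : A1 \subset B1.
    by apply/subsetP=> x; have /subsetP/(_ (Some x)) := sAB; rewrite !mem_Some.
  have A1_0 : A1 != set0 by apply: contraNneq A0 => ->; rewrite imset0.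
  have [x [xA xB]] := (leT i).2 A1 B1 AE BE A1_0 sAB1.
  exact: (interval_tight_cvx (lin i) sAB1 xA xB).
have Etf' : twin_free E'.
  (* Covering enters here: each vertex lies in a hyperedge, the added point in none. *)
  have nN x : ~ twins E' (Some x) None.
    case=> _; have [A AE xA] := Ecov x.
    by move/(_ (Some @: A)); rewrite mem_None mem_Some xA => /(_ (imset_f _ AE)).
  move=> [x|] [y|]; [|exact: nN| |by case].
    move=> [xy h]; apply: (Etf x y); split=> [e|A AE]; first by case: xy; rewrite e.
    by rewrite -(mem_Some A x) -(mem_Some A y); apply/h/imset_f.
  by case=> _ h; apply: (nN y); split=> // A AE; rewrite h.
have Econ' : graph_connected E' (@strictly_intersect (option V)).
  move=> _ _ /imsetP[A AE ->] /imsetP[B BE ->].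
  have [q Rq ->] := connectP (Econ _ _ AE BE).
  elim: q A {AE} Rq => [|C q IH] A //= /andP[/and3P[AE CE AC] Rq].
  apply: connect_trans (IH _ Rq); apply: connect1.
  by rewrite /= !imset_f //; apply: strictly_intersect_Some.
have [t st] := sign_constant p_inj nT Ecvx Etight Econ' Etf'.
(* Triples through the added point compare the two linear orders. *)
have eqle x y : x != y -> (le1 x y == le2 x y) = t.
  move=> xy; rewrite -(st None (Some x) (Some y)) // /sign.
  by rewrite (cyc_orank (lin true)) ?(cyc_orank (lin false)).
have [r1 _ _ _] := lin true; have [r2 a2 _ t2] := lin false.
case: t {st} eqle => eqle; [left|right] => x y.
  have [<-|/eqle/eqP//] := eqVneq x y.
  exact: (etrans (r1 x) (esym (r2 x))).
have [<-|xy] := eqVneq x y; first exact: (etrans (r1 x) (esym (r2 x))).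
have : ~~ (le2 x y && le2 y x) by apply: contraNN xy => /a2 ->.
have := eqle _ _ xy; have := t2 x y.
by rewrite /=; case: (le1 x y); case: (le2 x y); case: (le2 y x).
Qed.
End LinearUniqueness.

(* The hypothesis on [set: V] \in E in the second part is not in the informal
   statement. It is vacuous when V is not a hyperedge. Without it the second
   part is false: take V with four vertices and E the four singletons together
   with V; then every circular ordering of V is a tight arc ordering. *)
Theorem theorem1p3 (V : finType) (E : {set {set V}}) :
  (twin_free E -> connected E ->
     forall le1 le2 : rel V,
       tight_interval_ordering E le1 -> tight_interval_ordering E le2 ->
       le1 =2 le2 \/ le1 =2 (fun x y => le2 y x))
  /\
  (twin_free E -> strictly_connected E ->
     ([set: V] \in E -> graph_connected (E :\ [set: V]) (@strictly_intersect V)) ->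
     forall s1 s2 : {perm V},
       tight_arc_ordering E s1 -> tight_arc_ordering E s2 ->
       s1 = s2 \/ s1 = (s2^-1)%g).
Proof.
split=> [Etf Econ le1 le2|Etf [_ Econ] EconT s1 s2].
  exact: tight_interval_ordering_unique.
apply: tight_arc_ordering_unique => //.
have [ET|ET] := boolP ([set: V] \in E); first exact: EconT.
suff -> : E :\ setT = E by [].
by apply/setP=> A; rewrite !inE; case: eqVneq => // ->; rewrite (negPf ET).
Qed.
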